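(* Let $A$ be a finite Abelian group and let $\{H_ix_i\mid i=1,\dots,k\}$ be an irredundant coset covering of $A$. Then for all $i\in\{1,\dots,k\}$, $k\geq 1+\log_2|A:H_i|$.
   Context: A coset covering of a group $A$ is a collection of cosets $H_ix_i$ (with $H_i\le A$ subgroups and $x_i\in A$) whose union is $A$. It is irredundant if none of its members can be omitted. *)

(* Defs.v *)
From mathcomp Require Import all_boot all_order all_algebra all_fingroup.
From mathcomp Require Import reals exp.

Set Implicit Arguments.
Unset Strict Implicit.
Unset Printing Implicit Defensive.

Import GroupScope.

Section CosetCoverings.

Variables (gT : finGroupType) (A : {group gT}) (k : nat).
Variables (H : 'I_k -> {group gT}) (x : 'I_k -> gT).

Definition coset_covering : Prop :=
  [/\ forall i, H i \subset A,
      forall i, x i \in A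
    & \bigcup_(i < k) (H i :* x i) = A].

(* Members are counted by index, so an irredundant covering repeats no coset. *)
Definition irredundant_coset_covering : Prop :=
  coset_covering /\ forall i, \bigcup_(j < k | j != i) (H j :* x j) <> A.

End CosetCoverings.

Definition log2 (R : realType) (r : R) : R := (ln r / ln 2%:R)%R.

(* Main.v *)
Require Import Defs.
From mathcomp Require Import all_boot all_order all_algebra all_fingroup.
From mathcomp Require Import algC classfun character.
From mathcomp Require Import reals exp.

(** Let [a] be a point covered by [H i :* x i] only, and for each [j != i] pick
    a linear character [chi_j] of [A], trivial on [H j], with
    [chi_j a != chi_j (x j)]. Then [f = \prod_(j != i) (chi_j - chi_j (x j))]
    vanishes off [H i :* x i] but not at [a], so its translates by
    representatives of the [#|A : H i|] cosets of [H i] are linearly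
    independent. They all lie in the span of the [2 ^ k.-1] products of
    subfamilies of the [chi_j]. *)

(** Distributing the product over the subsets of [I] makes each entry a sum of terms, each a
    function of [r] times a function of [s]. The matrix thus factors as [U *m V] with one inner
    index per subset. *)
Lemma rank_prod_affine (F : fieldType) (m n : nat) (I : finType)
    (a : I -> 'I_m -> F) (b : I -> 'I_n -> F) (c : I -> F) :
  (\rank (\matrix_(r, s) \prod_j (a j r * b j s + c j))%R <= 2 ^ #|I|)%N.
Proof.
rewrite -cardsT -card_powerset powersetT cardsT.
pose B (l : 'I_#|{set I}|) : {set I} := enum_val l.
pose U := (\matrix_(r < m, l < #|{set I}|)
             \prod_j (if j \in B l then a j r else 1))%R.
pose V := (\matrix_(l < #|{set I}|, s < n)
             \prod_j (if j \in B l then b j s else c j))%R.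
suff -> : (\matrix_(r, s) \prod_j (a j r * b j s + c j) = U *m V)%R.
  exact: mulmx_max_rank.
apply/matrixP=> r s; rewrite !mxE bigA_distr big_enum_val; apply: eq_bigr => l _.
rewrite !mxE -big_split /=; apply: eq_bigr => j _.
by rewrite /B; case: ifP; rewrite ?GRing.mul1r.
Qed.

(** In an abelian group [H] is normal, hence the intersection of the kernels of the irreducible
    characters trivial on it, and all of these are linear. *)
Lemma lin_char_separates (gT : finGroupType) (A H : {group gT}) (y : gT) :
    abelian A -> H \subset A -> y \in A -> y \notin H ->
  exists chi : 'CF(A),
    [/\ chi \is a linear_char, H \subset cfker chi & (chi y != 1)%R].
Proof.
move=> abelA sHA Ay.
have nHA : (H <| A)%g by rewrite -sub_abelian_normal.
have linA := char_abelianP _ abelA.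
rewrite -[in y \notin _](cap_cfker_normal nHA) => /bigcapP.
case: (pickP (fun i : Iirr A =>
  (H \subset cfker ('chi_i)%R) && (y \notin cfker ('chi_i)%R))) => [i|ker_y].
  case/andP=> sHi; rewrite cfkerEirr inE (lin_char1 (linA i)) => chi_y _.
  by exists ('chi_i)%R.
by case=> i sHi; move: (ker_y i); rewrite sHi => /negbFE.
Qed.

(** Sampling the translates of [f] at representatives of the cosets of [H] gives a nonzero scalar
    matrix of order [#|A : H|], whose rank [rank_prod_affine] bounds. *)
Lemma abelian_index_le_cover_but_coset (gT : finGroupType) (A H : {group gT})
    (I : finType) (K : I -> {group gT}) (z : I -> gT) (a : gT) :
    abelian A -> H \subset A -> (forall j, K j \subset A) ->
    (forall j, z j \in A) -> a \in A -> (forall j, a \notin K j :* z j)%g ->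
    A :\: (H :* a)%g \subset \bigcup_j (K j :* z j)%g ->
  (#|A : H|%g <= 2 ^ #|I|)%N.
Proof.
move=> abelA sHA sKA Az Aa a_notin cover.
have chi_ex j : exists chi : 'CF(A),
    [/\ chi \is a linear_char, K j \subset cfker chi
      & (chi (a * (z j)^-1)%g != 1)%R].
  apply: lin_char_separates => //; first by rewrite groupM ?groupV.
  by rewrite -mem_rcoset.
have [chi chiP] := fin_all_exists chi_ex.
pose t (r : 'I_#|rcosets H A|) : gT := repr (enum_val r).
have tP r : t r \in A /\ enum_val r = (H :* t r)%g.
  have /rcosetsP[y Ay Er] := enum_valP r.
  rewrite /t Er rcoset_repr; split=> //.
  by apply: subsetP (mem_repr_rcoset H y); rewrite mul_subG ?sub1set.
(* Entry [(r, s)] is [f (a * (t r)^-1 * t s)], split by multiplicativity of [chi j] into the form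
   that [rank_prod_affine] needs. *)
pose M := (\matrix_(r, s < #|rcosets H A|) \prod_j
  (chi j (a * (t r)^-1)%g * chi j (t s) + - chi j (z j)))%R.
pose d := (\prod_j (chi j a - chi j (z j)))%R.
have Md : M = (d%:M)%R.
  apply/matrixP=> r s; have [At Er] := tP r; have [As Es] := tP s.
  have Mrs j : (chi j (a * (t r)^-1)%g * chi j (t s)
                = chi j (a * (t r)^-1 * t s)%g)%R.
    have [lin_chi _ _] := chiP j.
    by rewrite -(lin_charM lin_chi) ?groupM ?groupV.
  rewrite !mxE; under eq_bigr do rewrite Mrs.
  have [<-|neq_rs] /= := eqVneq r s.
    by rewrite GRing.mulr1n; apply: eq_bigr => j _; rewrite mulgKV.
  (* Off the diagonal the argument of [f] avoids [H :* a]: otherwise, by commutativity,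
     [t s * (t r)^-1] would lie in [H] and the two cosets would coincide. So some [K j :* z j]
     contains it, and the factor at [j] vanishes. *)
  have /bigcupP[j _ /rcosetP[h Kh ->]] :
      (a * (t r)^-1 * t s)%g \in \bigcup_j (K j :* z j)%g.
    apply: (subsetP cover).
    have Ag : (a * (t r)^-1 * t s)%g \in A by rewrite !groupM ?groupV.
    rewrite inE mem_rcoset Ag andbT.
    apply: contra neq_rs => H_rs; apply/eqP/enum_val_inj.
    rewrite Er Es; apply/esym/rcoset_eqP; rewrite mem_rcoset.
    suff -> : (t s * (t r)^-1 = a * (t r)^-1 * t s * a^-1)%g by [].
    have cA := centsP abelA.
    rewrite (cA _ Ag) ?groupV // -!mulgA mulKg.
    by apply: cA; rewrite ?groupV.
  have [lin_chi sKj _] := chiP j.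
  rewrite (bigD1 j) //= cfkerMl ?(subsetP sKj) //.
  by rewrite GRing.subrr GRing.mul0r.
have nz_d : (d != 0)%R.
  apply/GRing.prodf_neq0 => j _; have [lin_chi _] := chiP j.
  rewrite (lin_charM lin_chi) ?groupV // (lin_charV lin_chi) //.
  apply: contra; rewrite GRing.subr_eq0 => /eqP->.
  by rewrite GRing.divff ?(lin_char_neq0 lin_chi).
have := rank_prod_affine _ _ _ _ (fun j r => chi j (a * (t r)^-1)%g)
  (fun j s => chi j (t s)) (fun j => - chi j (z j))%R.
by rewrite -/M Md -scalemx1 mxrank_scale_nz // mxrank1.
Qed.

Lemma irredundant_coset_covering_index_le (gT : finGroupType) (A : {group gT})
    (k : nat) (H : 'I_k -> {group gT}) (x : 'I_k -> gT) (i : 'I_k) :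
  abelian A -> irredundant_coset_covering A H x -> (#|A : H i|%g <= 2 ^ k.-1)%N.
Proof.
case: k H x i => [|k] H x i abelA; first by case: i.
case=> -[sHA Ax covA] irr.
have sHxA j : (H j :* x j)%g \subset A by rewrite mul_subG ?sub1set.
have [a Aa a_notin] :
    exists2 a, a \in A & a \notin \bigcup_(j < k.+1 | j != i) (H j :* x j)%g.
  apply/subsetPn/negP => sA; apply: (irr i); apply/eqP.
  by rewrite eqEsubset sA andbT; apply/bigcupsP.
(* The covering reaches [a] only through its [i]-th member, so [a] can replace [x i] as
   representative. *)
have Hx_a : (H i :* x i = H i :* a)%g.
  move: (Aa); rewrite -covA => /bigcupP[j _ Hj_a].
  apply/esym/rcoset_eqP; case: (eqVneq j i) Hj_a => [->//|neq_ji] Hj_a.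
  by case/bigcupP: a_notin; exists j.
(* After the case split there are [k.+1] cosets; [lift i] indexes the [k] others by ['I_k]. *)
rewrite -[in leqRHS](card_ord k).
apply: (abelian_index_le_cover_but_coset _ _ _ _ (fun j => H (lift i j))
          (fun j => x (lift i j)) a) => // [j|].
  apply: contra a_notin => Hj_a; apply/bigcupP; exists (lift i j) => //.
  by rewrite eq_sym neq_lift.
apply/subsetP=> y; rewrite -Hx_a inE => /andP[Hi_y].
rewrite -covA => /bigcupP[j _]; case: (unliftP i j) => [j' ->|->] Hj_y.
  by apply/bigcupP; exists j'.
by rewrite Hj_y in Hi_y.
Qed.

Theorem corollary6 (R : realType) (gT : finGroupType) (A : {group gT})
    (k : nat) (H : 'I_k -> {group gT}) (x : 'I_k -> gT)
    (abelA : abelian A)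
    (covA : irredundant_coset_covering A H x) :
  forall i : 'I_k, (1 + log2 (#|A : H i|%g%:R : R) <= k%:R)%R.
Proof.
move=> i; have := irredundant_coset_covering_index_le _ _ _ _ _ i abelA covA.
have k_gt0 : (0 < k)%N by exact: leq_ltn_trans (ltn_ord i).
have ln2 : (0 < ln (2%:R : R))%R by rewrite ln_gt0 // Num.Theory.ltr1n.
(* Writing [k] as [1 + k.-1] cancels the summand 1; what remains is the logarithm of the bound
   [2 ^ k.-1]. *)
rewrite -[in k%:R%R](prednK k_gt0) -(GRing.nat1r) => leA.
rewrite Num.Theory.lerD2l /log2 Num.Theory.ler_pdivrMr // GRing.mulr_natl.
rewrite -lnXn ?Num.Theory.ltr0n // ler_ln ?Num.Theory.posrE.
- by rewrite -GRing.natrX Num.Theory.ler_nat.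
- by rewrite Num.Theory.ltr0n indexg_gt0.
- by rewrite Num.Theory.exprn_gt0 // Num.Theory.ltr0n.
Qed.
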